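(* There are sufficiently large absolute constants $C_1,C_2$ such that the following holds. Let $0<\theta<1/140$ and $C>0$. For each $N$, let $p=p(N)\in(CN^{-\theta},1]$ and let $W$ be a random subset of $\mathbb{Z}_N$ in which the events $x\in W$, $x\in\mathbb{Z}_N$, are independent and each has probability $p$. Assume that $\alpha$ and $k$ satisfy $$\alpha\geq\frac{C_1\log\log N}{\sqrt{\log N}},\qquad k\leq \exp\left( \frac{\alpha^2\log\log N}{C_2\log\frac{1}{\alpha}\left(\log\log\log N+\log\frac{1}{\alpha}\right)}\right).$$ Then the probability that the statement ''for every set $A\subset W$ with $|A|\geq\alpha|W|$, the sumset $A+A$ contains a $k$-term arithmetic progression'' holds is $1-o_{k,\alpha}(1)$ as $N\to\infty$.
   Context: $A+A=\{a+b:\ a,b\in A\}\subset\mathbb{Z}_N$. Here $o_{k,\alpha}(1)$ denotes a quantity tending to $0$ as $N\to\infty$, at a rate that may depend on $k,\alpha$. *)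

(* Defs.v *)
From HB Require Import structures.
From mathcomp Require Import all_boot all_order all_algebra.
From mathcomp Require Import all_classical all_reals all_analysis.

Set Implicit Arguments.
Unset Strict Implicit.
Unset Printing Implicit Defensive.

Import Order.TTheory GRing.Theory Num.Theory.
Import numFieldNormedType.Exports.

Local Open Scope ring_scope.

Definition sumset (N : nat) (A : {set 'Z_N}) : {set 'Z_N} :=
  [set a + b | a in A, b in A]%SET.

(* The k terms must be distinct: in 'Z_N with N composite, a nonzero common
   difference alone would allow a progression to wrap around onto itself. *)
Definition has_kAP (N k : nat) (S : {set 'Z_N}) : Prop :=
  exists a d : 'Z_N,
    injective (fun i : 'I_k => a + d *+ i) /\
    (forall i : 'I_k, a + d *+ i \in S).

Definition mutually_independent (R : realType) (d : measure_display)
    (T : measurableType d) (P : probability T R) (I : finType)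
    (E : I -> set T) : Prop :=
  forall J : {set I},
    P (\bigcap_(i in [set` J]) E i)%classic = (\prod_(i in J) P (E i))%E.

Definition random_subset (R : realType) (d : measure_display)
    (T : measurableType d) (P : probability T R) (I : finType)
    (p : R) (W : T -> {set I}) : Prop :=
  let event_in (x : I) : set T := [set w | x \in W w]%classic in
  [/\ forall x, measurable (event_in x),
      mutually_independent P event_in &
      forall x, P (event_in x) = p%:E].

(* Main.v *)
(* Since the error term may depend on k and alpha, these can be fixed. Write f for
   the indicator of A and w for that of W, both divided by p, and xi = w - 1. With
   high probability the autocorrelation of xi has mean square at most a small
   multiple of p ^ 12, by a first-moment computation: the expectation of
   xi (s + y) xi y xi z xi (s + z) vanishes unless s = 0, y = z or z = s + y.

   For such W it suffices to find a generic t for which u = f * f is L2-close to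
   its translate by t: then some x has u (x + i t) > 0 for all i < k. Put
   h = f (. + t) - f and let M be convolution with the autocorrelation F of f. Then
   the squared distance in question is <h, M h>. Cauchy-Schwarz and the
   pseudorandomness of xi allow w to be replaced by 1, which bounds <h, M h> in
   terms of the norm of M h, and the square <h, M M h> of the latter in terms of
   the norm of M M h. Now M M f is the convolution of two functions bounded in L2,
   so its translate by t is determined, up to a small L2 error, by boundedly many
   values F (y_j - t) at sample points y_j; quantising these values and applying
   the pigeonhole principle yields many translates close to each other. *)

Require Import Defs.
From HB Require Import structures.
From mathcomp Require Import all_boot all_order all_algebra.
From mathcomp Require Import all_classical all_reals all_analysis.
From mathcomp Require Import ring lra zify.

Set Implicit Arguments.
Unset Strict Implicit.
Unset Printing Implicit Defensive.

Import Order.TTheory GRing.Theory Num.Theory.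
Import numFieldNormedType.Exports.

Local Open Scope classical_set_scope.
Local Open Scope ring_scope.

(** * Averages over a finite type *)

Definition avg (R : realType) (T : finType) (phi : T -> R) : R :=
  (\sum_x phi x) / #|T|%:R.

Notation "\avg_ x F" := (avg (fun x => F))
  (at level 36, F at level 36, x at level 0, format "\avg_ x  F").

Section Averages.
Variables (R : realType) (T : finType).
Implicit Types phi psi : T -> R.

Lemma eq_avg phi psi : phi =1 psi -> avg phi = avg psi.
Proof. by move=> e; congr (_ / _); apply: eq_bigr => x _. Qed.

Lemma avgD phi psi : \avg_x (phi x + psi x) = avg phi + avg psi.
Proof. by rewrite /avg big_split mulrDl. Qed.

Lemma avgMl a phi : \avg_x (a * phi x) = a * avg phi.
Proof. by rewrite /avg -mulr_sumr mulrA. Qed.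

Lemma avgMr a phi : \avg_x (phi x * a) = avg phi * a.
Proof. by rewrite mulrC -avgMl; apply: eq_avg => x; rewrite mulrC. Qed.

Lemma avgN phi : \avg_x (- phi x) = - avg phi.
Proof. by rewrite /avg sumrN mulNr. Qed.

Lemma avgB phi psi : \avg_x (phi x - psi x) = avg phi - avg psi.
Proof. by rewrite avgD avgN. Qed.

Lemma avg_sum (I : Type) (s : seq I) (phi : I -> T -> R) :
  \avg_x (\sum_(i <- s) phi i x) = \sum_(i <- s) avg (phi i).
Proof. by rewrite /avg exchange_big mulr_suml. Qed.

Lemma le_avg phi psi : (forall x, phi x <= psi x) -> avg phi <= avg psi.
Proof.
by move=> le; rewrite ler_wpM2r ?invr_ge0 ?ler0n// ler_sum// => x _; exact: le.
Qed.

Lemma avg_ge0 phi : (forall x, 0 <= phi x) -> 0 <= avg phi.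
Proof. by move=> h; rewrite divr_ge0 ?ler0n ?sumr_ge0// => x _; exact: h. Qed.

Lemma avg_reindex (g : T -> T) phi : injective g -> \avg_x phi (g x) = avg phi.
Proof.
move=> inj; congr (_ / _); rewrite [RHS](reindex g)//.
by apply: onW_bij; exact: injF_bij.
Qed.

Lemma avg_sqr_ge0 phi : 0 <= \avg_x phi x ^+ 2.
Proof. by apply: avg_ge0 => x; exact: sqr_ge0. Qed.

Lemma avg_CS phi psi :
  (\avg_x (phi x * psi x)) ^+ 2 <= (\avg_x phi x ^+ 2) * \avg_x psi x ^+ 2.
Proof.
set a := \avg_x phi x ^+ 2; set b := \avg_x (_ * _); set c := \avg_x psi x ^+ 2.
have quad s t : 0 <= s ^+ 2 * a + s * t * 2 * b + t ^+ 2 * c.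
  rewrite /a /b /c -!avgMl -!avgD; apply: avg_ge0 => x.
  rewrite (_ : _ + _ = (s * phi x + t * psi x) ^+ 2) ?sqr_ge0//.
  by ring.
have a0 : 0 <= a by exact: avg_sqr_ge0.
have c0 : 0 <= c by exact: avg_sqr_ge0.
(* For [a = 0] the form at [t = 1] is affine in [s]; if its slope were nonzero, [s = - (c + 1) / b]
   would give the negative value [- c - 2]. Otherwise the form is tested in its minimising direction
   [(b, - a)]. *)
have [a_eq0|a_neq0] := eqVneq a 0.
  have [->|b_neq0] := eqVneq b 0; first by rewrite expr0n mulr_ge0.
  have := quad (- (c + 1) / b) 1; rewrite a_eq0.
  rewrite (_ : _ + _ = - c - 2); first by lra.
  by field.
have a_gt0 : 0 < a by rewrite lt0r a_neq0.
rewrite -subr_ge0.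
have := quad b (- a); rewrite (_ : _ + _ = a * (a * c - b ^+ 2)); last by ring.
by rewrite pmulr_rge0.
Qed.

Lemma avg_cst (x0 : T) (a : R) : avg (fun _ : T => a) = a.
Proof.
rewrite /avg sumr_const -[a *+ _]mulr_natr mulfK// pnatr_eq0 -lt0n.
by apply/card_gt0P; exists x0.
Qed.

Lemma sqr_avg_le phi : (avg phi) ^+ 2 <= \avg_x phi x ^+ 2.
Proof.
case: (pickP T) => [x0 _|T0]; last first.
  by rewrite /avg !big_pred0 ?mul0r ?expr0n//.
have := avg_CS phi (fun=> 1).
rewrite (_ : \avg_x (_ * 1) = avg phi); last by apply: eq_avg => x; rewrite mulr1.
by rewrite expr1n avg_cst// mulr1.
Qed.

Lemma avg_weighted_CS f phi : (forall x, 0 <= f x) ->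
  (\avg_x (f x * phi x)) ^+ 2 <= avg f * \avg_x (f x * phi x ^+ 2).
Proof.
move=> f0; have := avg_CS (fun x => Num.sqrt (f x)) (fun x => Num.sqrt (f x) * phi x).
congr (_ ^+ 2 <= _ * _); apply: eq_avg => x.
- by rewrite mulrA -expr2 sqr_sqrtr.
- by rewrite sqr_sqrtr.
- by rewrite exprMn sqr_sqrtr.
Qed.

Lemma exists_le_avg (x0 : T) phi : exists x, phi x <= avg phi.
Proof.
apply/not_existsP => H; have : avg phi < avg phi; last by rewrite ltxx.
rewrite -{1}(avg_cst x0 (avg phi)) /avg ltr_pM2r; last first.
  by rewrite invr_gt0 ltr0n; apply/card_gt0P; exists x0.
apply: ltr_sum; last by move=> i _; rewrite ltNge; apply/negP; exact: H.
by apply/hasP; exists x0; rewrite ?mem_index_enum.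
Qed.

Lemma markov_card phi a : 0 < a -> (forall x, 0 <= phi x) ->
  a * #|[set x | a < phi x]%SET|%:R <= #|T|%:R * avg phi.
Proof.
move=> a0 phi0; have [T0|Tn0] := eqVneq #|T| 0%N.
  rewrite T0 mul0r (_ : #|_| = 0%N) ?mulr0//.
  by apply/eqP; rewrite -leqn0 -T0 max_card.
rewrite /avg [leRHS]mulrC divfK ?pnatr_eq0// mulr_natr -sumr_const.
rewrite [leRHS](bigID (fun x => x \in [set x | a < phi x]%SET))/= -[leLHS]addr0.
by apply: lerD; rewrite ?sumr_ge0//; apply: ler_sum => x; rewrite inE => /ltW.
Qed.

End Averages.

Lemma exchange_avg (R : realType) (T U : finType) (phi : T -> U -> R) :
  \avg_x \avg_y phi x y = \avg_y \avg_x phi x y.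
Proof.
rewrite /avg -!mulr_suml -!mulrA [_^-1 / _]mulrC; congr (_ * _).
exact: exchange_big.
Qed.

Lemma avg_pair (R : realType) (T U : finType) (phi : T -> U -> R) :
  \avg_x \avg_y phi x y = \avg_z phi z.1 z.2.
Proof.
rewrite /avg card_prod natrM invfM -mulr_suml pair_big/=.
by rewrite -mulrA [_^-1 / _]mulrC.
Qed.

(** * Correlations and increments on a finite abelian group *)

Section Correlations.
Variables (R : realType) (G : finZmodType).
Implicit Types (a f g h : G -> R) (t x : G).

Lemma avg_shift t g : \avg_x g (x + t) = avg g.
Proof. exact/avg_reindex/addIr. Qed.

Lemma avg_opp g : \avg_x g (- x) = avg g.
Proof. exact/avg_reindex/oppr_inj. Qed.

Definition opp a : G -> R := fun x => a (- x).

(** [cor a] is convolution with the reflection [opp a]. The autocorrelation [cor a a] is even, so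
    [cor (cor a a)] is also convolution with [cor a a] itself. *)
Definition cor a g : G -> R := fun x => \avg_y (a y * g (x + y)).

Definition normsq g : R := \avg_x g x ^+ 2.

Definition incr t g : G -> R := fun x => g (x + t) - g x.

Lemma normsq_ge0 g : 0 <= normsq g. Proof. exact: avg_sqr_ge0. Qed.

Lemma cor_ge0 a g : (forall x, 0 <= a x) -> (forall x, 0 <= g x) ->
  forall x, 0 <= cor a g x.
Proof. by move=> a0 g0 x; apply: avg_ge0 => y; rewrite mulr_ge0. Qed.

Lemma cor_alt a g x : cor a g x = \avg_y (a (y - x) * g y).
Proof.
rewrite -(avg_shift x); apply: eq_avg => y; rewrite addrK.
by rewrite [y + x]addrC.
Qed.

Lemma cor_adj a g h : \avg_x (h x * cor a g x) = \avg_x (cor (opp a) h x * g x).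
Proof.
transitivity (\avg_x \avg_y (h x * a (y - x) * g y)).
  apply: eq_avg => x; rewrite cor_alt -avgMl.
  by apply: eq_avg => y; rewrite mulrA.
rewrite exchange_avg; apply: eq_avg => y.
rewrite cor_alt -avgMr; apply: eq_avg => x.
by rewrite /opp opprB [h x * _]mulrC.
Qed.

Lemma cor_comm a b g : cor a (cor b g) = cor b (cor a g).
Proof.
apply/funext => x; rewrite /cor.
under eq_avg do rewrite -avgMl.
under [RHS]eq_avg do rewrite -avgMl.
rewrite exchange_avg; apply: eq_avg => y; apply: eq_avg => z.
by rewrite mulrCA; congr (_ * (_ * g _)); rewrite addrAC.
Qed.

(** As [cor (opp a)] is the adjoint of [cor a], this exhibits correlation with [cor a a] as a
    positive operator, whose quadratic form is a squared norm. *)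
Lemma cor_opp_cor a g : cor (opp a) (cor a g) = cor (cor a a) g.
Proof.
apply/funext => x; rewrite /cor.
transitivity (\avg_z \avg_y (a z * a (z + y) * g (x + y))); last first.
  rewrite exchange_avg; apply: eq_avg => y; rewrite -avgMr.
  by apply: eq_avg => z; rewrite [y + z]addrC.
rewrite -avg_opp; apply: eq_avg => z; rewrite /opp opprK -avgMl.
rewrite -(avg_shift z); apply: eq_avg => y.
by rewrite -mulrA [y + z]addrC; congr (_ * (_ * g _)); rewrite addrA subrK.
Qed.

Lemma cor_incr a g t : cor a (incr t g) = incr t (cor a g).
Proof.
apply/funext => x; rewrite /cor /incr -avgB; apply: eq_avg => y.
by rewrite mulrBr addrAC.
Qed.

Lemma incr_adj g h t : \avg_x (incr t h x * g x) = \avg_x (h x * incr (- t) g x).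
Proof.
rewrite /incr; under eq_avg do rewrite mulrBl.
under [RHS]eq_avg do rewrite mulrBr.
rewrite !avgB; congr (_ - _).
rewrite -(avg_shift t (fun x => h x * _)); apply: eq_avg => x.
by rewrite addrK.
Qed.

Lemma normsq_shift g t : \avg_x g (x + t) ^+ 2 = normsq g.
Proof. exact: (avg_shift t (fun x => g x ^+ 2)). Qed.

Lemma normsq_incr g t : normsq (incr t g) <= 4 * normsq g.
Proof.
have : normsq (incr t g) <= \avg_x (2 * g (x + t) ^+ 2 + 2 * g x ^+ 2).
  apply: le_avg => x; rewrite /incr; have := sqr_ge0 (g (x + t) + g x); lra.
by rewrite avgD !avgMl normsq_shift -/(normsq g); move/le_trans; apply; lra.
Qed.

(** Young's inequality for L1 and L2: Cauchy-Schwarz with weight [a] at each point, then averaging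
    over translates. *)
Lemma normsq_cor a g : (forall x, 0 <= a x) ->
  normsq (cor a g) <= avg a ^+ 2 * normsq g.
Proof.
move=> a0; have : normsq (cor a g) <=
    \avg_x (avg a * \avg_y (a y * g (x + y) ^+ 2)).
  by apply: le_avg => x; apply: (@avg_weighted_CS _ _ a (fun y => g (x + y))).
move/le_trans; apply; rewrite avgMl expr2 -mulrA ler_wpM2l ?avg_ge0//.
rewrite exchange_avg; under eq_avg do rewrite avgMl normsq_shift.
by rewrite avgMr.
Qed.

Lemma avg_oppf a : avg (opp a) = avg a.
Proof. exact: avg_opp. Qed.

Lemma cor_autocor a : cor (cor a a) a = cor (opp a) (cor a a).
Proof. by rewrite cor_opp_cor. Qed.

Lemma avg_cor a g : avg (cor a g) = avg a * avg g.
Proof.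
rewrite /cor exchange_avg -avgMr; apply: eq_avg => y.
by rewrite avgMl; congr (_ * _); exact: avg_shift.
Qed.

End Correlations.

(** * Transference from a pseudorandom weight to the constant 1 *)

Lemma le_of_sqr (R : realType) (x y : R) : 0 <= y -> x ^+ 2 <= y ^+ 2 -> x <= y.
Proof. by move=> y0; apply: contra_le => xy; nra. Qed.

Section Transference.
Variables (R : realType) (G : finZmodType) (f w : G -> R) (b kap : R).
Let xi : G -> R := fun x => w x - 1.
Let F : G -> R := cor f f.
Hypotheses (f_ge0 : forall x, 0 <= f x) (f_le : forall x, f x <= w x).
Hypotheses (w_le : forall x, w x <= b) (b_ge1 : 1 <= b).
Hypotheses (kap_ge0 : 0 <= kap) (kap_le : kap <= 1 / 2).
Hypothesis pseudorandom : normsq (cor xi xi) <= kap ^+ 4 / b ^+ 12.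

Let b_gt0 : 0 < b. Proof. exact: lt_le_trans b_ge1. Qed.

Let kap_sqr : kap ^+ 2 <= 1 / 4.
Proof.
rewrite (_ : 1 / 4 = (1 / 2) ^+ 2); last by field.
by rewrite lerXn2r ?nnegrE// divr_ge0.
Qed.

Let r_le : normsq (cor xi xi) <= kap ^+ 4.
Proof.
apply: (le_trans pseudorandom); rewrite ler_pdivrMr ?exprn_gt0//.
by rewrite ler_peMr ?exprn_ge0// exprn_ege1.
Qed.

(** The average of [cor xi xi] is [avg xi ^+ 2], so pseudorandomness also controls the mean of
    [w]. *)
Lemma avg_xi_sqr : avg xi ^+ 2 <= 1 / 4.
Proof.
have : (avg xi ^+ 2) ^+ 2 <= (kap ^+ 2) ^+ 2.
  apply: le_trans (_ : _ <= normsq (cor xi xi)) _.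
    by rewrite [avg xi ^+ 2]expr2 -(avg_cor xi xi); exact: sqr_avg_le.
  by rewrite -exprM.
move/le_of_sqr => /(_ (sqr_ge0 _)) /le_trans; exact.
Qed.

Lemma avg_w : avg w = 1 + avg xi.
Proof. by rewrite /xi avgB (avg_cst 0) addrC subrK. Qed.

Lemma avg_w_ge : 1 / 2 <= avg w.
Proof. by rewrite avg_w; have := avg_xi_sqr; nra. Qed.

Lemma avg_f_ge0 : 0 <= avg f. Proof. exact: avg_ge0. Qed.

Lemma avg_f_le : avg f <= 2.
Proof.
apply: le_trans (le_avg f_le) _; rewrite avg_w; have := avg_xi_sqr; nra.
Qed.

Lemma F_ge0 s : 0 <= F s. Proof. exact: cor_ge0. Qed.

Lemma F_le s : F s <= 2 + cor xi xi s.
Proof.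
apply: le_trans (_ : cor w w s <= _).
  by apply: le_avg => y; rewrite ler_pM.
rewrite (_ : cor w w s = 1 + 2 * avg xi + cor xi xi s).
  by rewrite lerD2r; have := avg_xi_sqr; nra.
rewrite mulrDl mul1r -{2}(avg_shift s xi) -{1}[1](avg_cst (0 : G)).
rewrite -!avgD; apply: eq_avg => y; rewrite /xi [s + y]addrC; ring.
Qed.

Lemma normsq_F : normsq F <= 10.
Proof.
apply: le_trans (_ : \avg_s (8 + 2 * cor xi xi s ^+ 2) <= _).
  apply: le_avg => s; apply: le_trans (_ : (2 + cor xi xi s) ^+ 2 <= _).
    by rewrite lerXn2r ?nnegrE ?(le_trans (F_ge0 s))// F_le.
  have := sqr_ge0 (cor xi xi s - 2); lra.
rewrite avgD avgMl (avg_cst (0 : G)) -/(normsq _).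
have : kap ^+ 4 <= (1 / 4) ^+ 2.
  by rewrite -[4%N]/(2 * 2)%N exprM lerXn2r ?nnegrE ?sqr_ge0// divr_ge0.
have := r_le; lra.
Qed.

Lemma F_le_sqr s : F s <= b ^+ 2.
Proof.
rewrite -[leRHS](avg_cst (0 : G)); apply: le_avg => y.
by rewrite expr2 ler_pM// (le_trans (f_le _)).
Qed.

Let K z z' := \avg_x (xi x * f (z - x) * f (z' - x)).

Lemma weighted_normsqE g :
  \avg_x (xi x * cor f g x ^+ 2) = \avg_z (g z.1 * g z.2 * K z.1 z.2).
Proof.
rewrite -(avg_pair (fun z z' => g z * g z' * K z z')) /K.
under [RHS]eq_avg do under eq_avg do rewrite -avgMl.
transitivity (\avg_x \avg_z \avg_z' (xi x * (f (z - x) * g z) * (f (z' - x) * g z'))).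
  apply: eq_avg => x; rewrite expr2 !cor_alt -avgMr -avgMl.
  by apply: eq_avg => z; rewrite mulrA avgMl.
rewrite exchange_avg; apply: eq_avg => z.
by rewrite exchange_avg; apply: eq_avg => z'; apply: eq_avg => x; ring.
Qed.

(** Once the square is expanded, averaging over [z] and over [z'] produces one factor [F (x - x')]
    each; the substitution [s = x - x'] leaves the autocorrelation of [xi]. *)
Lemma normsq_K :
  \avg_z (K z.1 z.2 ^+ 2) = \avg_s (cor xi xi s * F s ^+ 2).
Proof.
have FE x x' : \avg_z (f (z - x) * f (z - x')) = F (x - x').
  rewrite -(avg_shift x); apply: eq_avg => y; rewrite addrK -addrA.
  by rewrite [y + _]addrC.
transitivity (\avg_x \avg_x' (xi x * xi x' * F (x - x') ^+ 2)).
  rewrite -(avg_pair (fun z z' => K z z' ^+ 2)).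
  transitivity (\avg_z \avg_z' \avg_x \avg_x'
     (xi x * xi x' * (f (z - x) * f (z - x')) * (f (z' - x) * f (z' - x')))).
    apply: eq_avg => z; apply: eq_avg => z'; rewrite expr2 /K -avgMr.
    apply: eq_avg => x; rewrite -avgMl; apply: eq_avg => x'; ring.
  under eq_avg do rewrite exchange_avg.
  rewrite exchange_avg; apply: eq_avg => x.
  under eq_avg do rewrite exchange_avg.
  rewrite exchange_avg; apply: eq_avg => x'.
  rewrite -FE expr2 -!avgMr -avgMl; apply: eq_avg => z.
  by rewrite -!mulrA -!avgMl; apply: eq_avg => z'; rewrite !mulrA.
rewrite exchange_avg /cor.
transitivity (\avg_x' \avg_s (xi x' * xi (s + x') * F s ^+ 2)).
  apply: eq_avg => x'; rewrite -(avg_shift x'); apply: eq_avg => s.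
  by rewrite addrK [xi x' * _]mulrC.
by rewrite exchange_avg; apply: eq_avg => s; rewrite avgMr.
Qed.

(* Cauchy-Schwarz removes the arbitrary function [g] and leaves the
   autocorrelation of [xi] tested against the bounded power [F ^+ 2], so that
   mean-square smallness of the former absorbs the crude bound on the latter. *)
Lemma weighted_normsq_le g :
  \avg_x (w x * cor f g x ^+ 2) <= normsq (cor f g) + kap / b * normsq g.
Proof.
rewrite -lerBlDl -avgB.
have -> : \avg_x (w x * cor f g x ^+ 2 - cor f g x ^+ 2) =
          \avg_x (xi x * cor f g x ^+ 2).
  by apply: eq_avg => x; rewrite /xi mulrBl mul1r.
have kb0 : 0 <= kap / b by rewrite divr_ge0// ltW.
apply: le_of_sqr; first by rewrite mulr_ge0// normsq_ge0.
rewrite weighted_normsqE.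
apply: le_trans (avg_CS (fun z : G * G => g z.1 * g z.2) _) _.
rewrite normsq_K exprMn mulrC.
have -> : avg (fun z : G * G => (g z.1 * g z.2) ^+ 2) = normsq g ^+ 2.
  rewrite -(avg_pair (fun z z' => (g z * g z') ^+ 2)) expr2 -avgMr.
  apply: eq_avg => z; rewrite -avgMl; apply: eq_avg => z'.
  by rewrite exprMn.
rewrite ler_wpM2r ?sqr_ge0//; apply: le_of_sqr; first exact: sqr_ge0.
apply: le_trans (avg_CS _ _) _.
(* This explains the exponent 12: [F ^+ 4] costs [b ^+ 8], and [b ^+ 4] must remain in the
   denominator to give [(kap / b) ^+ 4]. *)
apply: le_trans (_ : kap ^+ 4 / b ^+ 12 * b ^+ 8 <= _).
  rewrite ler_pM ?avg_sqr_ge0// -[leRHS](avg_cst (0 : G)).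
  apply: le_avg => s; rewrite -exprM -[8%N]/(2 * (2 * 2))%N [leRHS]exprM.
  by rewrite lerXn2r ?nnegrE ?F_ge0 ?F_le_sqr// sqr_ge0.
by rewrite le_eqVlt; apply/orP; left; apply/eqP; field; rewrite gt_eqF.
Qed.

(** Cauchy-Schwarz with weight [f] replaces the other factor by its square, after which [f] can be
    majorised by [w]. The 2 bounds [avg f]. *)
Lemma transference g :
  (\avg_x (f x * cor f g x)) ^+ 2 <= 2 * (normsq (cor f g) + kap / b * normsq g).
Proof.
apply: le_trans (avg_weighted_CS _ f_ge0) _.
apply: ler_pM; rewrite ?avg_f_ge0 ?avg_f_le//.
  by apply: avg_ge0 => x; rewrite mulr_ge0 ?sqr_ge0.
apply: le_trans (weighted_normsq_le g).
by apply: le_avg => x; rewrite ler_wpM2r ?sqr_ge0.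
Qed.

Lemma transference_incr t g :
  (\avg_x (incr t f x * cor f g x)) ^+ 2 <=
  8 * (normsq (cor f g) + kap / b * normsq g).
Proof.
rewrite incr_adj -cor_incr; apply: le_trans (transference _) _.
have kb0 : 0 <= kap / b by rewrite divr_ge0// ltW.
have := ler_wpM2l kb0 (normsq_incr g (- t)).
by have := normsq_incr (cor f g) (- t); rewrite cor_incr; lra.
Qed.

Lemma normsq_f : normsq f <= 2 * b.
Proof.
apply: le_trans (_ : \avg_x (f x * b) <= _).
  by apply: le_avg => x; rewrite expr2 ler_wpM2l// (le_trans (f_le _)).
by rewrite avgMr ler_wpM2r ?avg_f_le// ltW.
Qed.

Lemma normsq_cor_f g : normsq (cor f g) <= 4 * normsq g.
Proof.
apply: le_trans (normsq_cor _ f_ge0) _; rewrite ler_wpM2r ?normsq_ge0//.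
have := avg_f_ge0; have := avg_f_le; nra.
Qed.

Lemma normsq_cor_opp g : normsq (cor (opp f) g) <= 4 * normsq g.
Proof.
apply: le_trans (normsq_cor _ _) _; first by move=> x; exact: f_ge0.
rewrite ler_wpM2r ?normsq_ge0// avg_oppf.
have := avg_f_ge0; have := avg_f_le; nra.
Qed.

Let M g := cor F g.

Let ME g : M g = cor f (cor (opp f) g).
Proof. by rewrite cor_comm cor_opp_cor. Qed.

Let errE c : kap / b * (c * b) = c * kap.
Proof. by field; rewrite gt_eqF. Qed.

(** [M] is [cor f] after [cor (opp f)], so transference applies to [cor (opp f) g]. A squared norm
    of order [b] is affordable because the error carries the factor [kap / b]. *)
Lemma energy_step t g n : normsq g <= n * b ->
  (\avg_x (incr t f x * M g x)) ^+ 2 <= 8 * (normsq (M g) + 4 * n * kap).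
Proof.
move=> gn; rewrite ME; apply: le_trans (transference_incr _ _) _.
rewrite ler_pM2l// lerD2l -errE ler_wpM2l ?divr_ge0 ?(ltW b_gt0)//.
apply: le_trans (normsq_cor_opp _) _.
by rewrite -mulrA ler_pM2l.
Qed.

Lemma normsq_incr_f t : normsq (incr t f) <= 8 * b.
Proof. have := normsq_incr f t; have := normsq_f; lra. Qed.

(** [cor (opp f) f] is the convolution of [f] with itself, and the squared norm of its increment is
    the quadratic form of [M] at [incr t f]. *)
Lemma energy_first t :
  normsq (incr t (cor (opp f) f)) ^+ 2 <=
  8 * (normsq (M (incr t f)) + 32 * kap).
Proof.
rewrite (_ : 32 = 4 * 8); last by ring.
rewrite -cor_incr; set h := incr t f.
suff -> : normsq (cor (opp f) h) = \avg_x (h x * M h x).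
  exact/energy_step/normsq_incr_f.
by rewrite ME cor_adj; apply: eq_avg => x; rewrite expr2.
Qed.

(** Self-adjointness of [M] turns [normsq (M h)] into the pairing of [h] with [M (M h)]. The 512 is
    4 times 128, as [normsq (M h)] is at most [128 * b]. *)
Lemma energy_second t :
  normsq (M (incr t f)) ^+ 2 <=
  8 * (normsq (incr t (M (M f))) + 512 * kap).
Proof.
rewrite (_ : 512 = 4 * 128); last by ring.
rewrite /M -!cor_incr; set h := incr t f; rewrite -/(M h) -/(M (M h)).
suff -> : normsq (M h) = \avg_x (h x * M (M h) x).
  apply: energy_step; rewrite ME.
  have := normsq_cor_f (cor (opp f) h); have := normsq_cor_opp h.
  by have := normsq_incr_f t; rewrite -/h; lra.
rewrite (ME (M h)) cor_adj.
transitivity (\avg_x (cor f (cor (opp f) h) x * M h x)).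
  by apply: eq_avg => x; rewrite -ME expr2.
under eq_avg do rewrite mulrC.
by rewrite [LHS]cor_adj; apply: eq_avg => x; rewrite mulrC.
Qed.

(** [M f] equals [cor (opp f) F], so it inherits the bound on [F], which does not involve [b]. *)
Lemma normsq_Mf : normsq (M f) <= 40.
Proof.
rewrite /M /F cor_autocor; apply: le_trans (normsq_cor_opp _) _.
by have := normsq_F; rewrite /F; lra.
Qed.

End Transference.

(** * Random sampling and almost periods of a correlation *)

Lemma sqr_sum_le (R : realType) (I : Type) (s : seq I) (a : I -> R) :
  (\sum_(i <- s) a i) ^+ 2 <= (size s)%:R * \sum_(i <- s) a i ^+ 2.
Proof.
elim: s => [|i s IH]; first by rewrite !big_nil expr0n mul0r.
rewrite !big_cons /=.
have : 0 <= \sum_(j <- s) (a i - a j) ^+ 2 by rewrite sumr_ge0// => j _; exact: sqr_ge0.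
have -> : \sum_(j <- s) (a i - a j) ^+ 2 = (size s)%:R * a i ^+ 2
    - 2 * a i * (\sum_(j <- s) a j) + \sum_(j <- s) a j ^+ 2.
  elim: s {IH} => [|j s IH]; first by rewrite !big_nil mul0r mulr0 subr0 addr0.
  rewrite !big_cons IH /= -[(size s).+1%:R]natr1; ring.
move: IH; rewrite -[(size s).+1%:R]natr1.
by move: (\sum_(j <- s) _) (\sum_(j <- s) _) => p q; lra.
Qed.

Lemma pigeonhole_fiber (T U : finType) (A : {set T}) (g : T -> U) (K : nat) :
  (K * #|U| < #|A|)%N -> exists c, (K < #|[set x in A | g x == c]%SET|)%N.
Proof.
move=> lt; apply/not_existsP => H; move: lt; rewrite ltnNge => /negP; apply.
rewrite -sum1_card (partition_big g xpredT)//= mulnC -sum_nat_const.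
apply: leq_sum => c _; rewrite sum1dep_card leqNgt.
by apply/negP => lt; apply: (H c).
Qed.

(* Points are chosen greedily: over a uniform next point the cross term
   averages to zero, so each choice adds at most one variance. *)
Lemma sampling (R : realType) (T Om : finType) (x0 : T) (X : T -> Om -> R) (m : nat) :
  exists2 s : seq T, size s = m &
    \avg_om ((\sum_(y <- s) (X y om - \avg_z X z om)) ^+ 2) <=
    m%:R * \avg_y \avg_om X y om ^+ 2.
Proof.
elim: m => [|m [s sm IH]].
  exists [::] => //; rewrite mul0r; under eq_avg do rewrite big_nil expr0n.
  by rewrite /avg sumr_const mul0rn mul0r.
pose S om := \sum_(y <- s) (X y om - \avg_z X z om).
have [y yle] := exists_le_avg x0
  (fun y => \avg_om ((X y om - \avg_z X z om + S om) ^+ 2)).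
exists (y :: s); first by rewrite /= sm.
under eq_avg do rewrite big_cons.
apply: (le_trans yle); rewrite -[m.+1%:R]natr1 mulrDl mul1r addrC.
apply: le_trans (lerD (lexx _) IH); rewrite [X in _ <= X + _]exchange_avg exchange_avg.
rewrite -avgD; apply: le_avg => om; rewrite -/(S om).
set mu := \avg_z X z om; set c := S om.
have -> : \avg_z ((X z om - mu + c) ^+ 2) =
    (\avg_z (X z om ^+ 2)) + (2 * (c - mu) * mu + (c - mu) ^+ 2).
  rewrite {3}/mu -avgMl -[X in _ + (_ + X)](avg_cst x0) -!avgD.
  by apply: eq_avg => z; ring.
by rewrite lerD2l; have := sqr_ge0 mu; lra.
Qed.

Section AlmostPeriods.
Variables (R : realType) (G : finZmodType) (F Q : G -> R) (B : R).
Hypotheses (F_ge0 : forall x, 0 <= F x) (B_gt0 : 0 < B).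
Hypotheses (normF : normsq F <= B) (normQ : normsq Q <= B).

Let v := cor F Q.

Let dev (s : seq G) t x := \sum_(y <- s) (F (y - t) * Q (x + y) - v (x + t)).

(** The outcomes are the pairs [(t, x)], so a single sample serves all translates on average. The
    second moment of one term factors into the squared norms of [F] and [Q]. *)
Lemma sampled_cor m : exists2 s : seq G, size s = m &
  \avg_t \avg_x (dev s t x ^+ 2) <= m%:R * B ^+ 2.
Proof.
pose X y (z : G * G) := F (y - z.1) * Q (z.2 + y).
have [s sm H] := sampling (0 : G) X m; exists s => //.
rewrite avg_pair; apply: le_trans (_ : _ <= m%:R * \avg_y \avg_z X y z ^+ 2) _.
  apply: le_trans H; rewrite le_eqVlt; apply/orP; left; apply/eqP.
  apply: eq_avg => -[t x]; rewrite /dev /=; congr (_ ^+ 2).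
  apply: eq_bigr => y _; congr (_ - _).
  rewrite /v /cor -(avg_shift (- t)); apply: eq_avg => z.
  by rewrite /X/= addrACA subrr addr0.
rewrite ler_wpM2l// expr2; apply: le_trans (_ : normsq F * normsq Q <= _).
  rewrite -[leRHS](avg_cst (0 : G)); apply: le_avg => y.
  rewrite -(avg_pair (fun t x => X y (t, x) ^+ 2)) /X/=.
  rewrite le_eqVlt; apply/orP; left; apply/eqP.
  transitivity (\avg_t (F (y - t) ^+ 2 * normsq Q)).
    apply: eq_avg => t; rewrite -(normsq_shift Q y) -avgMl.
    by apply: eq_avg => x; rewrite exprMn.
  rewrite avgMr; congr (_ * _).
  rewrite -(avg_opp (fun t => F (y - t) ^+ 2)) -(normsq_shift F y).
  by apply: eq_avg => t; rewrite opprK addrC.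
by rewrite ler_pM ?normsq_ge0.
Qed.

Lemma close_translates (s : seq G) (delta c : R) (t t' : G) :
  (0 < size s)%N ->
  \avg_x (dev s t x ^+ 2) <= (size s)%:R * c ->
  \avg_x (dev s t' x ^+ 2) <= (size s)%:R * c ->
  (forall y, y \in s -> `|F (y - t) - F (y - t')| <= delta) ->
  normsq (incr (t - t') v) <= 3 * (delta ^+ 2 * B + 2 * c / (size s)%:R).
Proof.
move=> s0 dt dt' Fd; set m := (size s)%:R : R.
have m0 : 0 < m by rewrite ltr0n.
rewrite -(normsq_shift _ t') -(ler_pM2l (exprn_gt0 2 m0)) /incr.
(* [W] compares the two sampled sums. Multiplied by [m], the difference of the two translates of [v]
   is [W] minus one sampling error plus the other; squaring three terms costs the factor 3. *)
pose W x := \sum_(y <- s) (F (y - t) - F (y - t')) * Q (x + y).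
have key x : m ^+ 2 * (v (x + t' + (t - t')) - v (x + t')) ^+ 2 <=
    3 * (W x ^+ 2 + dev s t x ^+ 2 + dev s t' x ^+ 2).
  rewrite -exprMn (_ : m * _ = W x - dev s t x + dev s t' x); last first.
    rewrite /W /dev addrA addrAC addrK -sumrN -!big_split/=.
    transitivity (\sum_(y <- s) (v (x + t) - v (x + t'))).
      by rewrite big_const_seq count_predT iter_addr_0 mulr_natl.
    by apply: eq_bigr => y _; ring.
  have := sqr_ge0 (W x + dev s t x); have := sqr_ge0 (W x - dev s t' x).
  have := sqr_ge0 (dev s t x + dev s t' x); lra.
rewrite -avgMl; apply: le_trans (le_avg key) _; rewrite avgMl !avgD.
have Wle : \avg_x W x ^+ 2 <= m ^+ 2 * (delta ^+ 2 * B).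
  apply: le_trans (_ : \avg_x (m * \sum_(y <- s) (delta ^+ 2 * Q (x + y) ^+ 2)) <= _).
    apply: le_avg => x; apply: le_trans (sqr_sum_le _ _) _.
    rewrite ler_wpM2l ?(ltW m0)// big_seq [leRHS]big_seq ler_sum// => y ys.
    rewrite exprMn ler_wpM2r ?sqr_ge0// -real_normK ?num_real//.
    rewrite lerXn2r ?nnegrE//; last exact: Fd.
    exact: le_trans (Fd _ ys).
  rewrite avgMl [m ^+ 2]expr2 -[leRHS]mulrA ler_wpM2l ?(ltW m0)// avg_sum.
  rewrite (_ : m * _ = \sum_(y <- s) (delta ^+ 2 * B)); last first.
    by rewrite big_const_seq count_predT iter_addr_0 mulr_natl.
  apply: ler_sum => y _; rewrite avgMl ler_wpM2l ?sqr_ge0//.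
  by rewrite (normsq_shift Q y).
have -> : m ^+ 2 * (3 * (delta ^+ 2 * B + 2 * c / m)) =
   3 * (m ^+ 2 * (delta ^+ 2 * B) + m * c + m * c).
  by field; rewrite gt_eqF.
by rewrite ler_pM2l// !lerD.
Qed.

(* [L] bounds the quantised values of [F] at typical translates of the sample
   points: at least half of all [t] have both a small sampling error and a
   controlled profile [(F (y - t))_y]. *)
Lemma almost_period (m K : nat) (delta : R) (bad : {set G}) :
  let L := Num.truncn ((4 * m%:R * B + 1) / delta) in
  (0 < m)%N -> 0 < delta -> (#|bad| <= K)%N -> (2 * (K * L.+1 ^ m) < #|G|)%N ->
  exists2 t, t \notin bad &
    normsq (incr t v) <= 3 * (delta ^+ 2 * B + 8 * B ^+ 2 / m%:R).
Proof.
move=> L m0 d0 badK Gbig.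
have mR : 0 < m%:R :> R by rewrite ltr0n.
have [s sm Hs] := sampled_cor m.
(* Both summands are normalised to have average at most 1, so [Phi] exceeds 4 on at most half of the
   group. *)
pose Phi t := (\avg_x (dev s t x ^+ 2)) / (m%:R * B ^+ 2) +
              (\sum_(y <- s) F (y - t) ^+ 2) / (m%:R * B).
have err_ge0 t : 0 <= (\avg_x (dev s t x ^+ 2)) / (m%:R * B ^+ 2).
  by rewrite divr_ge0 ?avg_sqr_ge0// mulr_ge0 ?sqr_ge0.
have sum_ge0 t : 0 <= (\sum_(y <- s) F (y - t) ^+ 2) / (m%:R * B).
  by rewrite divr_ge0 ?mulr_ge0 ?(ltW B_gt0)// sumr_ge0// => y _; exact: sqr_ge0.
have avgPhi : avg Phi <= 2.
  rewrite avgD (avgMr _ (fun t => \avg_x (dev s t x ^+ 2))) avgMr.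
  rewrite -[leRHS]/(1 + 1); apply: lerD.
    by rewrite ler_pdivrMr ?mulr_gt0 ?exprn_gt0// mul1r.
  rewrite ler_pdivrMr ?mulr_gt0// mul1r avg_sum -sm.
  rewrite (_ : _ * B = \sum_(y <- s) B); last first.
    by rewrite big_const_seq count_predT iter_addr_0 mulr_natl.
  apply: ler_sum => y _; apply: le_trans normF.
  rewrite -(avg_opp (fun t => F (y - t) ^+ 2)) -(normsq_shift F y).
  by apply: le_avg => t; rewrite opprK addrC.
pose S := [set t | 4%:R < Phi t]%SET; pose A := (~: S)%SET.
have cardA : (#|G| <= 2 * #|A|)%N.
  have := @markov_card _ _ Phi 4%:R (ltr0Sn R 3)
    (fun t => addr_ge0 (err_ge0 t) (sum_ge0 t)).
  move/le_trans => /(_ _ (ler_wpM2l (ler0n _ _) avgPhi)).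
  rewrite -!natrM ler_nat => le4.
  have eG : (#|S| + #|A| = #|G|)%N := cardsC _.
  have {}le4 : (4 * #|S| <= #|G| * 2)%N := le4.
  by lia.
pose g t := [ffun i : 'I_m =>
  inord (Num.truncn (F (nth 0 s i - t) / delta)) : 'I_L.+1].
have [|c] := @pigeonhole_fiber _ _ A g K.
  by rewrite card_ffun !card_ord; lia.
set cls := [set x in A | _]%SET => cK.
have /card_gt0P [t' t'c] : (0 < #|cls|)%N by lia.
(* Translating the class by [- t'] yields more than [K] distinct differences, which cannot all be in
   [bad]. *)
have [t tc tbad] : exists2 t, t \in cls & t - t' \notin bad.
  have : ~~ ([set t - t' | t in cls]%SET \subset bad).
    apply/negP => /subset_leq_card; rewrite card_imset; last exact: addIr.
    by move=> le; have := leq_trans cK (leq_trans le badK); rewrite ltnn.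
  by case/subsetPn => _ /imsetP[t tc ->] tb; exists t.
exists (t - t') => //.
have inA u : u \in cls ->
    \avg_x (dev s u x ^+ 2) <= (size s)%:R * (4 * B ^+ 2) /\
    forall i, (i < m)%N -> F (nth 0 s i - u) / delta < L.+1%:R.
  rewrite !inE -leNgt => /andP[Phi4 _]; split.
    have : (\avg_x (dev s u x ^+ 2)) / (m%:R * B ^+ 2) <= 4.
      by apply: le_trans Phi4; rewrite /Phi lerDl.
    by rewrite ler_pdivrMr ?mulr_gt0 ?exprn_gt0// sm mulrCA.
  move=> i im; have : (\sum_(y <- s) F (y - u) ^+ 2) / (m%:R * B) <= 4.
    by apply: le_trans Phi4; rewrite /Phi lerDr.
  rewrite ler_pdivrMr ?mulr_gt0// mulrA => sum4.
  have Fi2 : F (nth 0 s i - u) ^+ 2 <= 4 * m%:R * B.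
    apply: le_trans sum4; rewrite (big_rem (nth 0 s i)) ?mem_nth ?sm//=.
    by rewrite lerDl sumr_ge0// => y _; exact: sqr_ge0.
  (* The bound on the square is turned into one on the value by [a <= a ^+ 2 + 1 / 4], which keeps
     square roots out of [L]. *)
  apply: le_lt_trans (_ : (4 * m%:R * B + 1) / delta < _).
    rewrite ler_pM2r ?invr_gt0//; have := sqr_ge0 (F (nth 0 s i - u) - 1 / 2); lra.
  have /truncn_itv/andP[_] // : 0 <= (4 * m%:R * B + 1) / delta.
  by rewrite divr_ge0 ?(ltW d0)// addr_ge0// !mulr_ge0// ltW.
have [et Ft] := inA _ tc; have [et' Ft'] := inA _ t'c.
apply: le_trans (close_translates (delta := delta) _ et et' _) _.
- by rewrite sm.
- move=> y /(nthP 0)[i]; rewrite sm => im <-.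
  have : g t = g t'.
    by move: tc t'c; rewrite !inE => /andP[_ /eqP ->] /andP[_ /eqP ->].
  move/ffunP/(_ (Ordinal im)); rewrite !ffunE => /(congr1 val) /=.
  have tr u : u \in cls ->
      (Num.truncn (F (nth 0 s i - u) / delta)%R < L.+1)%N.
    move=> uc; rewrite truncn_lt_nat ?divr_ge0 ?(ltW d0)//.
    by have [_] := inA _ uc; apply.
  rewrite !inordK ?tr// => etr.
  have itv u : 0 <= F (nth 0 s i - u) / delta by rewrite divr_ge0// ltW.
  have /andP[l1 u1] := truncn_itv (itv t).
  have /andP[l2 u2] := truncn_itv (itv t').
  rewrite -etr -natr1 in l2 u2; rewrite -natr1 in u1.
  set a := F (_ - t) in l1 u1 l2 u2 *; set a' := F (_ - t') in l2 u2 *.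
  have : `|a / delta - a' / delta| <= 1 by rewrite ler_norml; apply/andP; split; lra.
  by rewrite -mulrBl normrM [`|_^-1|]gtr0_norm ?invr_gt0// ler_pdivrMr// mul1r.
- rewrite sm ler_pM2l// lerD2l ler_pM2r ?invr_gt0//; lra.
Qed.

End AlmostPeriods.

(** * Progressions in the support of an almost periodic function *)

Lemma normsq_incr_mulrn (R : realType) (G : finZmodType) (u : G -> R) t (i : nat) :
  normsq (incr (t *+ i) u) <= i%:R ^+ 2 * normsq (incr t u).
Proof.
have tele x : incr (t *+ i) u x = \sum_(0 <= j < i) incr t u (x + t *+ j).
  rewrite /incr; elim: i => [|i IH]; first by rewrite big_geq// mulr0n addr0 subrr.
  by rewrite big_nat_recr//= -IH mulrSr [x + (_ + _)]addrA; ring.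
have le x : incr (t *+ i) u x ^+ 2 <=
    i%:R * \sum_(0 <= j < i) incr t u (x + t *+ j) ^+ 2.
  by rewrite tele -{2}(subn0 i) -(size_iota 0 (i - 0)); exact: sqr_sum_le.
apply: le_trans (le_avg le) _; rewrite avgMl avg_sum expr2 -mulrA ler_wpM2l//.
under eq_bigr do rewrite normsq_shift.
by rewrite sumr_const_nat subn0 mulr_natl.
Qed.

(** If each [x] had some [i < k] with [u (x + t *+ i) = 0], then [u x] would be, up to sign, the
    increment of step [t *+ i] at [x]. Summing the squares of these [k] increments costs
    [k * k ^+ 2]. *)
Lemma progression_in_support (R : realType) (G : finZmodType) (u : G -> R) t (k : nat) :
  k%:R ^+ 3 * normsq (incr t u) < avg u ^+ 2 ->
  exists x, forall i, (i < k)%N -> u (x + t *+ i) != 0.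
Proof.
apply: contraPP => /forallNP H; apply/negP; rewrite -leNgt.
have le x : u x ^+ 2 <= \sum_(0 <= i < k) incr (t *+ i) u x ^+ 2.
  have /existsNP[i /not_implyP[ik /negP/negPn/eqP ui]] := H x.
  rewrite (bigD1_seq i) ?mem_index_iota ?iota_uniq//= {1}/incr ui sub0r sqrrN.
  by rewrite lerDl sumr_ge0// => j _; exact: sqr_ge0.
apply: le_trans (sqr_avg_le _) _; apply: le_trans (le_avg le) _.
rewrite avg_sum exprS -mulrA mulr_natl.
rewrite -[X in _ *+ X](subn0 k) -(sumr_const_nat k 0) big_nat [leRHS]big_nat.
apply: ler_sum => i /andP[_ ik].
apply: le_trans (normsq_incr_mulrn _ _ _) _.
by rewrite ler_wpM2r ?normsq_ge0// lerXn2r ?nnegrE// ler_nat ltnW.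
Qed.

(** * Sumsets of dense subsets of a pseudorandom set *)

Definition weight (R : realType) (G : finZmodType) (b : R) (S : {set G}) : G -> R :=
  fun x => b * (x \in S)%:R.

Definition deviation (R : realType) (G : finZmodType) (b : R) (S : {set G}) : G -> R :=
  fun x => weight b S x - 1.

Lemma avg_weight (R : realType) (G : finZmodType) (b : R) (S : {set G}) :
  avg (weight b S) = b * #|S|%:R / #|G|%:R.
Proof.
rewrite /avg /weight -mulr_sumr; congr (_ * _ / _).
by rewrite -sum1_card natr_sum [RHS]big_mkcond; apply: eq_bigr => x _; case: ifP.
Qed.

(** [kap] and [n0] are uniform in the group and in [b]. The set [bad] serves to exclude differences
    along which a progression would repeat a term. *)
Lemma pseudorandom_progression (R : realType) (alpha : R) (k K : nat) : 0 < alpha ->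
  exists2 kap : R, 0 < kap & exists n0 : nat,
  forall (G : finZmodType) (S A bad : {set G}) (b : R),
    (n0 <= #|G|)%N -> 1 <= b ->
    normsq (cor (deviation b S) (deviation b S)) <= kap ^+ 4 / b ^+ 12 ->
    A \subset S -> alpha * #|S|%:R <= #|A|%:R -> (#|bad| <= K)%N ->
  exists x t, t \notin bad /\
    forall i, (i < k)%N -> x + t *+ i \in [set y + z | y in A, z in A]%SET.
Proof.
move=> alpha0.
(* Tolerances chosen backwards. The self-convolution of [f] has average at least [alpha ^+ 2 / 4],
   so [k%:R ^+ 3 * e0] must stay below [alpha ^+ 4 / 16]. In each energy inequality half of the
   squared target goes to the next tolerance and half to [kap]. *)
pose e0 := alpha ^+ 4 / (32 * k.+1%:R ^+ 3).
pose e1 := e0 ^+ 2 / 16; pose e2 := e1 ^+ 2 / 16.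
have e0_gt0 : 0 < e0 by rewrite divr_gt0 ?mulr_gt0 ?exprn_gt0.
have e1_gt0 : 0 < e1 by rewrite divr_gt0 ?exprn_gt0.
have e2_gt0 : 0 < e2 by rewrite divr_gt0 ?exprn_gt0.
have [kap [kap_gt0 kap_le kap0 kap1]] : exists kap : R, [/\ 0 < kap, kap <= 1 / 2,
    512 * kap <= e0 ^+ 2 & 16 * 512 * kap <= e1 ^+ 2].
  have sqr0 := exprn_gt0 2 e0_gt0; have sqr1 := exprn_gt0 2 e1_gt0.
  pose z := Num.min 1 (Num.min (e0 ^+ 2) (e1 ^+ 2)).
  have z_gt0 : 0 < z by rewrite !lt_min ltr01 sqr0.
  have z1 : z <= 1 by rewrite ge_min lexx.
  have z2 : z <= e0 ^+ 2 by rewrite !ge_min lexx orbT.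
  have z3 : z <= e1 ^+ 2 by rewrite !ge_min lexx !orbT.
  exists (z / (16 * 512)); split; lra.
(* In the bound of [almost_period] with [B = 40], the quantisation [delta] and the sample size [m]
   each take at most half of [e2]. *)
have [delta [delta_gt0 delta_le1 delta_le]] : exists delta : R,
    [/\ 0 < delta, delta <= 1 & delta * 240 <= e2].
  pose z := Num.min 1 e2.
  have z_gt0 : 0 < z by rewrite !lt_min ltr01.
  have z1 : z <= 1 by rewrite ge_min lexx.
  have z2 : z <= e2 by rewrite !ge_min lexx orbT.
  exists (z / 240); split; lra.
pose m := (Num.truncn (240 * 320 / e2)).+1.
pose L := Num.truncn ((4 * m%:R * 40 + 1) / delta).
exists kap => //; exists (2 * (K * L.+1 ^ m)).+1.
move=> G S A bad b Gbig b1 rle AS Adense badK.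
pose f := weight b A; pose w := weight b S.
have b0 : 0 < b by exact: lt_le_trans b1.
have kap_ge0 := ltW kap_gt0.
have f_ge0 x : 0 <= f x by rewrite mulr_ge0// ltW.
have f_le x : f x <= w x.
  rewrite ler_wpM2l ?(ltW b0)// ler_nat.
  by case xA: (x \in A) => //; rewrite (fintype.subsetP AS).
have w_le x : w x <= b by rewrite ler_piMr ?(ltW b0)//; case: (x \in S).
have [t tbad D2] : exists2 t, t \notin bad &
    normsq (incr t (cor (cor f f) (cor (cor f f) f))) <= e2.
  have nF : normsq (cor f f) <= 40.
    apply: le_trans (normsq_F f_ge0 f_le b1 kap_ge0 kap_le rle) _; lra.
  have nQ := normsq_Mf f_ge0 f_le b1 kap_ge0 kap_le rle.
  have [t tbad le] := almost_period (cor_ge0 f_ge0 f_ge0) (ltr0Sn R 39) nF nQ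
    (ltn0Sn _) delta_gt0 badK Gbig.
  exists t => //; apply: (le_trans le).
  have m_le : (240 * 320) / m%:R <= e2.
    rewrite ler_pdivrMr ?ltr0n// [e2 * _]mulrC -ler_pdivrMr//.
    exact/ltW/truncnS_gt.
  have delta2 : delta ^+ 2 <= delta by rewrite expr2 ger_pMl.
  rewrite (_ : 8 * 40 ^+ 2 / m%:R = ((240 * 320) / m%:R) / 6); last first.
    by field; rewrite pnatr_eq0.
  by lra.
have := energy_second f_ge0 f_le w_le b1 kap_ge0 kap_le rle t.
have := energy_first f_ge0 f_le w_le b1 kap_ge0 kap_le rle t.
set D0 := normsq _; set D1 := normsq _ => D0le D1le.
have {}D1le : D1 <= e1.
  by apply: le_of_sqr; rewrite ?(ltW e1_gt0)//; rewrite /e2 in D2; lra.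
have {}D0le : D0 <= e0.
  by apply: le_of_sqr; rewrite ?(ltW e0_gt0)//; rewrite /e1 in D1le; lra.
have avgf : alpha / 2 <= avg f.
  have := avg_w_ge b1 kap_ge0 kap_le rle.
  rewrite avg_weight -/w => wge.
  have : alpha * (b * #|S|%:R / #|G|%:R) <= b * #|A|%:R / #|G|%:R.
    by rewrite mulrA ler_wpM2r ?invr_ge0// mulrCA ler_wpM2l// ltW.
  rewrite /f avg_weight; apply: le_trans.
  by rewrite ler_wpM2l ?(ltW alpha0)//; lra.
have [x xP] : exists x, forall i, (i < k)%N -> cor (opp f) f (x + t *+ i) != 0.
  apply: progression_in_support; rewrite -/D0 avg_cor avg_oppf.
  apply: lt_le_trans (_ : (alpha / 2 * (alpha / 2)) ^+ 2 <= _); last first.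
    have a2 : 0 <= alpha / 2 by rewrite divr_ge0// ltW.
    have f2 := le_trans a2 avgf.
    by apply: lerXn2r; rewrite ?nnegrE; [exact: mulr_ge0|exact: mulr_ge0|exact: ler_pM].
  apply: le_lt_trans (_ : alpha ^+ 4 / 32 < _); last first.
    have := exprn_gt0 4 alpha0.
    by rewrite (_ : (_ * _) ^+ 2 = alpha ^+ 4 / 16); [lra|field].
  apply: le_trans (_ : k.+1%:R ^+ 3 * e0 <= _).
    rewrite ler_pM ?exprn_ge0 ?normsq_ge0// lerXn2r ?nnegrE// ler_nat.
    exact: leqnSn.
  rewrite le_eqVlt; apply/orP; left; apply/eqP; rewrite /e0.
  have : k.+1%:R ^+ 3 != 0 :> R by rewrite expf_neq0// pnatr_eq0.
  by move: (_ ^+ 3) => c c0; field.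
exists x, t; split=> // i ik; have /eqP := xP i ik; apply: contra_notT => nin.
(* Off the sumset every product vanishes, since the arguments [- y] and [x + t *+ i + y] add up to
   [x + t *+ i]. *)
rewrite /cor; rewrite -[RHS](avg_cst (0 : G)); apply: eq_avg => y.
rewrite /opp /f /weight; case yA: (- y \in A); last by rewrite mulr0 mul0r.
case zA: (x + t *+ i + y \in A); last by rewrite !mulr0.
move/negP: nin; case; apply/imset2P; exists (- y) (x + t *+ i + y) => //.
by rewrite [RHS]addrCA addNr addr0.
Qed.

(** * The law of the random set and the autocorrelation of its deviation *)

(** Replaces the probability space by a finite law on subsets, so that expectations become finite
    sums. Independence is kept in the form of inclusion probabilities. *)
Lemma random_subset_law (R : realType) (d : measure_display) (T : measurableType d)
    (P : probability T R) (I : finType) (p : R) (W : T -> {set I}) :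
  random_subset P p W ->
  exists pr : {set I} -> R, [/\ forall S, 0 <= pr S,
    forall J : {set I}, \sum_S pr S * (J \subset S)%:R = p ^+ #|J| &
    forall Q : pred {set I}, P [set w | Q (W w)] = (\sum_(S | Q S) pr S)%:E].
Proof.
case=> mE indep PE; pose pr S := fine (P [set w | W w = S]).
have mW S : measurable [set w | W w = S].
  rewrite (_ : [set w | _] = \bigcap_(x in [set: I])
      (if x \in S then [set w | x \in W w] else ~` [set w | x \in W w])).
    apply: fin_bigcap_measurable; first exact: finite_finset.
    by move=> x _; case: ifP => _; [|apply: measurableC]; exact: mE.
  apply/seteqP; split=> [w /= <- x _|w wS /=].
    by case: ifP => //= /negbT/negP.
  apply/setP => x; have := wS x Logic.I.
  by case: (x \in S) => //= /negP/negbTE.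
have law (Q : pred {set I}) : P [set w | Q (W w)] = (\sum_(S | Q S) pr S)%:E.
  rewrite (_ : [set w | _] = \bigcup_(S in [set` Q]) [set w | W w = S]).
    rewrite (measure_fin_bigcup P (finite_finpred Q))//; last first.
      by move=> S S' _ _ [w /= []] <- <-.
    rewrite -sumEFin; symmetry; transitivity
        (\sum_(S <- index_enum {set I} | S \in Q) P [set w | W w = S])%E.
      by apply: eq_bigr => S _; rewrite /pr fineK// fin_num_measure.
    apply: bigfs; first exact: index_enum_uniq.
    by move=> S _; rewrite mem_index_enum.
  by apply/seteqP; split=> [w Qw|w [S QS]]; [exists (W w)|move=> /= ->].
exists pr; split=> // [S|J]; first exact: fine_ge0.
apply: (@EFin_inj R); rewrite (bigID (fun S : {set I} => J \subset S))/=.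
rewrite [X in (_ + X)%:E]big1 ?addr0; last by move=> S /negbTE ->; rewrite mulr0.
under eq_bigr => S -> do rewrite mulr1.
rewrite -(law (fun S => J \subset S)).
rewrite (_ : [set w | _] = \bigcap_(i in [set` J]) [set w | i \in W w]).
  by rewrite indep; under eq_bigr do rewrite PE; rewrite prodEFin prodr_const.
by apply/seteqP; split=> [w /fintype.subsetP JW x /JW|w H]; [|apply/fintype.subsetP].
Qed.

Section RandomDeviation.
Variables (R : realType) (G : finZmodType) (p : R) (pr : {set G} -> R).
Hypotheses (p_gt0 : 0 < p) (p_le1 : p <= 1) (pr_ge0 : forall S, 0 <= pr S).
Hypothesis pr_subset : forall J : {set G}, \sum_S pr S * (J \subset S)%:R = p ^+ #|J|.

Let xi S : G -> R := deviation p^-1 S.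

(** The indicator of [J \subset S] carries the induction on [l]: multiplied by [xi S y] it becomes a
    combination of the indicators for [y |: J] and [J], neither containing [a]. At the end, adding
    [a] to [J] multiplies the inclusion probability by [p], which [p^-1] cancels. *)
Lemma expect_deviation_prod (a : G) (l : seq G) (J : {set G}) :
  a \notin l -> a \notin J ->
  \sum_S pr S * ((J \subset S)%:R * xi S a * \prod_(y <- l) xi S y) = 0.
Proof.
have xiE y (K S : {set G}) : (K \subset S)%:R * xi S y =
    p^-1 * (y |: K \subset S)%:R - (K \subset S)%:R.
  rewrite /xi /deviation /weight finset.subUset finset.sub1set mulrBr mulr1 mulrCA.
  by rewrite -natrM mulnb andbC.
elim: l J => [|y l IH] J al aJ.
  under eq_bigr do rewrite big_nil mulr1 xiE mulrBr mulrCA.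
  rewrite sumrB -mulr_sumr !pr_subset cardsU1 aJ exprS mulKf ?subrr//.
  by rewrite gt_eqF.
move: al; rewrite inE negb_or => /andP[ay al].
under eq_bigr => S _.
  rewrite big_cons (_ : _ * _ =
    p^-1 * (pr S * ((y |: J \subset S)%:R * xi S a * \prod_(j <- l) xi S j))
    - pr S * ((J \subset S)%:R * xi S a * \prod_(j <- l) xi S j)); last first.
    transitivity
      (pr S * (((J \subset S)%:R * xi S y) * xi S a * \prod_(j <- l) xi S j)).
      by ring.
    by rewrite xiE; ring.
  over.
rewrite sumrB -mulr_sumr !IH ?mulr0 ?subr0//.
by rewrite !inE negb_or ay.
Qed.

Lemma expect_distinguished (a b c e : G) : a \notin [:: b; c; e] ->
  \sum_S pr S * (xi S a * xi S b * xi S c * xi S e) = 0.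
Proof.
move=> al; have a0 : a \notin (finset.set0 : {set G}) by rewrite inE.
rewrite -[RHS](expect_deviation_prod al a0).
apply: eq_bigr => S _; rewrite finset.sub0set mul1r !big_cons big_nil mulr1.
by rewrite !mulrA.
Qed.

Lemma normr_deviation S x : `|xi S x| <= p^-1.
Proof.
have p1 : 1 <= p^-1 by rewrite invf_ge1.
rewrite /xi /deviation /weight ler_norml.
by case: (x \in S); rewrite /= ?mulr1 ?mulr0; lra.
Qed.

Lemma sum_pr : \sum_S pr S = 1.
Proof.
rewrite -[RHS](expr0 p) -(cards0 G) -pr_subset.
by apply: eq_bigr => S _; rewrite finset.sub0set mulr1.
Qed.

(** Without a coincidence [s + y] differs from the other three points and the expectation vanishes;
    otherwise each factor is bounded by [p^-1]. *)
Lemma expect_quadruple (y z s : G) :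
  \sum_S pr S * (xi S (s + y) * xi S y * xi S z * xi S (s + z)) <=
  p^-1 ^+ 4 * ((s == 0)%:R + (y == z)%:R + (z == s + y)%:R).
Proof.
have ge0 (e : bool) : 0 <= e%:R :> R by [].
have p4 : 0 <= p^-1 ^+ 4 by rewrite exprn_ge0// invr_ge0 ltW.
have [/or3P e|] := boolP [|| s == 0, y == z | z == s + y].
  apply: (@le_trans _ _ (p^-1 ^+ 4)).
    rewrite -[leRHS]mul1r -sum_pr mulr_suml; apply: ler_sum => S _.
    rewrite ler_wpM2l// (le_trans (ler_norm _))// !normrM.
    rewrite -[4%N]/(1 + 1 + 1 + 1)%N !exprD expr1.
    by rewrite !ler_pM ?mulr_ge0 ?normr_deviation.
  rewrite ler_peMr//; move: (ge0 (s == 0)) (ge0 (y == z)) (ge0 (z == s + y)).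
  by case: e => ->; rewrite mulr1n => g1 g2 g3; lra.
rewrite !negb_or => /and3P[s0 yz zsy].
rewrite expect_distinguished; first by apply: mulr_ge0 => //; rewrite !addr_ge0.
rewrite !inE !negb_or -{2}[y]add0r (inj_eq (addIr _)) s0 eq_sym zsy/=.
by rewrite (inj_eq (addrI _)).
Qed.

Lemma avg_indicator (c : G) : \avg_y ((y == c)%:R : R) = #|G|%:R^-1.
Proof.
rewrite /avg -[RHS]mul1r; congr (_ / _).
rewrite (bigD1 c)//= eqxx big1 ?addr0// => y /negbTE -> //.
Qed.

Lemma expect_normsq_autocor :
  \sum_S pr S * normsq (cor (xi S) (xi S)) <= 3 * p^-1 ^+ 4 / #|G|%:R.
Proof.
have expand S : normsq (cor (xi S) (xi S)) =
    \avg_s \avg_y \avg_z (xi S (s + y) * xi S y * xi S z * xi S (s + z)).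
  apply: eq_avg => s; rewrite expr2 /cor -avgMr; apply: eq_avg => y.
  by rewrite -avgMl; apply: eq_avg => z; ring.
under eq_bigr do rewrite expand -avgMl.
rewrite -avg_sum.
apply: le_trans (_ : \avg_s \avg_y \avg_z
  (p^-1 ^+ 4 * ((s == 0)%:R + (y == z)%:R + (z == s + y)%:R)) <= _).
  apply: le_avg => s; under eq_bigr do rewrite -avgMl.
  rewrite -avg_sum; apply: le_avg => y; under eq_bigr do rewrite -avgMl.
  by rewrite -avg_sum; apply: le_avg => z; exact: expect_quadruple.
rewrite le_eqVlt; apply/orP; left; apply/eqP.
transitivity (\avg_s
  (p^-1 ^+ 4 * ((s == 0 :> G)%:R + #|G|%:R^-1 + #|G|%:R^-1)) : R).
  apply: eq_avg => s; rewrite -[RHS](avg_cst (0 : G)); apply: eq_avg => y.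
  rewrite avgMl !avgD (avg_cst (0 : G)) avg_indicator; congr (_ * (_ + _ + _)).
  by rewrite -(avg_indicator y); apply: eq_avg => z; rewrite eq_sym.
rewrite avgMl !avgD (avg_cst (0 : G)) avg_indicator.
by ring.
Qed.

Lemma deviation_tail (lam : R) : 0 < lam ->
  \sum_(S | lam < normsq (cor (xi S) (xi S))) pr S <=
  3 * p^-1 ^+ 4 / #|G|%:R / lam.
Proof.
move=> lam0; rewrite ler_pdivlMr//; apply: le_trans expect_normsq_autocor.
rewrite mulr_suml [leRHS](bigID (fun S => lam < normsq (cor (xi S) (xi S))))/=.
rewrite -[leLHS]addr0 lerD ?sumr_ge0// => [|S _]; last first.
  by rewrite mulr_ge0 ?normsq_ge0.
by apply: ler_sum => S lt; rewrite ler_wpM2l// ltW.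
Qed.

End RandomDeviation.

(** * Differences of small order in a cyclic group *)

Lemma card_Zp_torsion (n i : nat) : (0 < i)%N ->
  (#|[set t : 'I_n.+1 | (t *+ i == 0)%R]%SET| <= i)%N.
Proof.
case: i => // i _; rewrite -[leqRHS]card_ord.
(* On torsion elements the division is exact, so the quotient, which lies below [i.+1], determines
   [t]. *)
apply: (@leq_card_in _ _ (fun t : 'I_n.+1 => inord ((t * i.+1) %/ n.+1) : 'I_i.+1)).
have lt (t : 'I_n.+1) : ((t * i.+1) %/ n.+1 < i.+1)%N.
  by rewrite ltn_divLR// mulnC ltn_pmul2l.
have dv (t : 'I_n.+1) : t \in [set t : 'I_n.+1 | (t *+ i.+1 == 0)%R]%SET ->
    (n.+1 %| t * i.+1)%N.
  by rewrite inE Zp_mulrn => /eqP/(congr1 val)/= e; rewrite /dvdn e.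
move=> t t' /dv tn /dv t'n /(congr1 val)/=; rewrite !inordK// => e.
apply/val_inj/eqP; rewrite /= -(eqn_pmul2r (ltn0Sn i)).
by rewrite -(divnK tn) -(divnK t'n) e.
Qed.

Definition torsion (n k : nat) : {set 'I_n.+1} :=
  (\bigcup_(i < k | (0 < i)%N) [set t : 'I_n.+1 | (t *+ i == 0)%R])%SET.

Lemma card_torsion (n k : nat) : (#|torsion n k| <= k * k)%N.
Proof.
rewrite -[X in (_ <= X * _)%N](card_ord k) -sum_nat_const /torsion.
rewrite [leqRHS](bigID (fun i : 'I_k => (0 < i)%N))/=.
apply: leq_trans (leq_addr _ _).
apply: (big_ind2 (fun (B : {set 'I_n.+1}) m => (#|B| <= m)%N)).
- by rewrite cards0.
- move=> B1 m1 B2 m2 le1 le2; rewrite cardsU.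
  by apply: leq_trans (leq_subr _ _) (leq_add le1 le2).
- by move=> i i0; apply: leq_trans (card_Zp_torsion n i0) (ltnW (ltn_ord i)).
Qed.

Lemma torsion_free_inj (n k : nat) (x t : 'I_n.+1) : t \notin torsion n k ->
  injective (fun i : 'I_k => x + t *+ i).
Proof.
move=> tt i j /= /addrI e; apply/val_inj => /=.
wlog ij : i j e / (i <= j)%N.
  by move=> H; case/orP: (leq_total i j) => ij; [|symmetry]; apply: H.
apply/eqP; rewrite eqn_leq ij/= leqNgt; apply: contra tt => lt.
have jik : (j - i < k)%N by rewrite (leq_ltn_trans (leq_subr _ _)).
apply/bigcupP; exists (Ordinal jik); rewrite /= ?subn_gt0//.
by rewrite inE mulrnBr// e subrr.
Qed.

(** * Error terms in [N] and the probability estimate *)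

Lemma inv_pow16_le (R : realType) (theta C p : R) (N : nat) :
  0 < theta -> theta < 1 / 140 -> 0 < C -> (0 < N)%N ->
  C * N%:R `^ (- theta) < p -> p^-1 ^+ 16 <= C^-1 ^+ 16 * Num.sqrt N%:R.
Proof.
move=> th0 th1 C0 N0 Cp.
have N1 : (1 : R) <= N%:R by rewrite ler1n.
have Nth : 0 < N%:R `^ theta :> R by rewrite powR_gt0// ltr0n.
have CN0 : 0 < C * N%:R `^ (- theta) by rewrite mulr_gt0// powR_gt0// ltr0n.
have p0 : 0 < p by exact: lt_trans Cp.
have pinv : p^-1 <= C^-1 * N%:R `^ theta.
  apply: le_trans (_ : (C * N%:R `^ (- theta))^-1 <= _).
    by rewrite lef_pV2 ?posrE// ltW.
  by rewrite invfM powRN invrK.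
apply: le_trans (_ : (C^-1 * N%:R `^ theta) ^+ 16 <= _).
  by apply: lerXn2r => //; rewrite nnegrE ?mulr_ge0 ?invr_ge0 ?ltW.
rewrite exprMn ler_wpM2l ?exprn_ge0 ?invr_ge0 ?(ltW C0)//.
(* The comparison of exponents is [16 * theta < 16 / 140 < 1 / 2]. *)
rewrite -powR_mulrn ?(ltW Nth)// -powRrM -powR12_sqrt// ler_powR//.
lra.
Qed.

Lemma cvg_div_sqrt (R : realType) (D : R) (N1 : nat) :
  (if (N < N1)%N then 1 else D / Num.sqrt N%:R) @[N --> \oo] --> (0 : R).
Proof.
apply/cvgr0Pnorm_lt => e e0; near=> N.
have N1N : (N1 <= N)%N by near: N; exact: nbhs_infty_ge.
have DN : (D / e) ^+ 2 < N%:R by near: N; exact: nbhs_infty_gtr.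
have N0 : 0 < N%:R :> R by exact: le_lt_trans (sqr_ge0 _) DN.
have sN0 : 0 < Num.sqrt N%:R :> R by rewrite sqrtr_gt0.
rewrite ltnNge N1N/= normrM normfV (gtr0_norm sN0) ltr_pdivrMr//.
rewrite mulrC -ltr_pdivrMr// -[X in _ / X](gtr0_norm e0) -normf_div.
by rewrite -sqrtr_sqr ltr_sqrt.
Unshelve. all: by end_near. Qed.

Lemma one_lt_ln (R : realType) (N : nat) :
  (Num.truncn (expR 1 : R) < N)%N -> 1 < ln (N%:R : R).
Proof.
move=> lt; have eN : expR 1 < N%:R :> R.
  by apply: lt_le_trans (truncnS_gt _) _; rewrite ler_nat.
by rewrite -[ltLHS]expRK ltr_ln ?posrE ?expR_gt0// (lt_trans (expR_gt0 1)).
Qed.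

Lemma progression_probability (R : realType) (theta C alpha : R) (k : nat) :
  0 < theta -> theta < 1 / 140 -> 0 < C -> 0 < alpha ->
  exists D : R, exists n0 : nat,
  forall (N : nat) (p : R), (2 < N)%N -> (n0 <= N)%N ->
    C * N%:R `^ (- theta) < p -> p <= 1 ->
  forall (d : measure_display) (T : measurableType d)
    (P : probability T R) (W : T -> {set 'Z_N}), random_subset P p W ->
  ((1 - D / Num.sqrt N%:R)%R%:E <=
    P [set w | forall A : {set 'Z_N}, A \subset W w ->
                 (alpha * #|W w|%:R <= #|A|%:R)%R -> has_kAP k (sumset A)])%E.
Proof.
move=> th0 th1 C0 alpha0.
have [kap kap0 [n0 det]] := pseudorandom_progression k (k * k) alpha0.
exists (3 * C^-1 ^+ 16 / kap ^+ 4), n0 => N p N2 n0N Cp p1 d T P W /random_subset_law.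
case=> pr [pr0 prJ law].
have N0 : (0 < N)%N by exact: ltn_trans N2.
have p0 : 0 < p by apply: lt_trans Cp; rewrite mulr_gt0// powR_gt0// ltr0n.
have b1 : 1 <= p^-1 by rewrite invf_ge1.
have cardZ : #|'Z_N| = N by rewrite card_ord Zp_cast// ltnW.
pose good (S : {set 'Z_N}) := `[< forall A : {set 'Z_N}, A \subset S ->
   alpha * #|S|%:R <= #|A|%:R -> has_kAP k (sumset A) >].
rewrite (_ : [set w | _] = [set w | good (W w)]); last first.
  by apply/seteqP; split=> w /asboolP.
rewrite law lee_fin.
pose lam := kap ^+ 4 / p^-1 ^+ 12.
have lam0 : 0 < lam by rewrite divr_gt0// exprn_gt0// invr_gt0.
pose dev (S : {set 'Z_N}) := normsq (cor (deviation p^-1 S) (deviation p^-1 S)) : R.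
have goodP (S : {set 'Z_N}) : dev S <= lam -> good S.
  move=> devS; apply/asboolP => A AS dense.
  have [|x [t [tt H]]] :=
      det _ S A (torsion _ k) p^-1 _ b1 devS AS dense (card_torsion _ k).
    by rewrite cardZ.
  by exists x, t; split; [exact: torsion_free_inj|move=> i; exact: H].
have tail := deviation_tail p0 p1 pr0 prJ lam0.
rewrite cardZ in tail.
have total : \sum_S pr S = 1.
  by have := sum_pr prJ.
apply: le_trans (_ : 1 - \sum_(S | lam < dev S) pr S <= _).
  rewrite lerD2l lerN2; apply: (le_trans tail).
  have := inv_pow16_le th0 th1 C0 N0 Cp.
  set b := p^-1; set s := Num.sqrt _ => b16.
  have b0 : 0 < b by rewrite invr_gt0.
  have s0 : 0 < s by rewrite sqrtr_gt0 ltr0n.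
  have NE : N%:R = s ^+ 2 :> R by rewrite sqr_sqrtr.
  have k4 : 0 < kap ^+ 4 by rewrite exprn_gt0.
  rewrite NE /lam -/b.
  (* The 16 is 4 from the expectation of the squared autocorrelation plus 12 from the threshold
     [lam]. One of the two factors [s] of [N] absorbs [b ^+ 16]. *)
  rewrite (_ : _ / _ = 3 / kap ^+ 4 / s ^+ 2 * b ^+ 16); last first.
    by field; rewrite !gt_eqF.
  rewrite (_ : 3 * _ / _ / _ = 3 / kap ^+ 4 / s ^+ 2 * (C^-1 ^+ 16 * s)); last first.
    by field; rewrite !gt_eqF.
  by rewrite ler_wpM2l// !divr_ge0 ?exprn_ge0// ltW.
rewrite lerBlDr -total (bigID good)/= lerD2l.
rewrite [leRHS]big_mkcond [leLHS]big_mkcond ler_sum// => S _.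
case: ifP => [/negP ng|_]; last by case: ifP.
by rewrite ltNge; case: ifP => // /negbFE /goodP.
Qed.

(* The function eta is the o_{k,alpha}(1) term.  The probability p is
   quantified separately for each N: for C >= 1 the interval ]C N^-theta, 1]
   is empty for small N, so a sequence p with values in it at every N would
   not exist.  The restriction 2 < N makes the iterated logarithms genuine. *)
Theorem theorem1p4 (R : realType) :
  exists C1 C2 : R, [/\ 0 < C1, 0 < C2 &
    forall theta C : R, 0 < theta -> theta < 1 / 140 -> 0 < C ->
    exists eta : nat -> R -> nat -> R,
      (forall (k : nat) (alpha : R), eta k alpha N @[N --> \oo] --> (0 : R)) /\
      forall (N : nat) (p : R), (2 < N)%N ->
        C * N%:R `^ (- theta) < p -> p <= 1 ->
      forall (d : measure_display) (T : measurableType d)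
        (P : probability T R) (W : T -> {set 'Z_N}),
        random_subset P p W ->
      forall (alpha : R) (k : nat),
        C1 * ln (ln N%:R) / Num.sqrt (ln N%:R) <= alpha ->
        k%:R <= expR (alpha ^+ 2 * ln (ln N%:R) /
                  (C2 * ln (1 / alpha) *
                    (ln (ln (ln N%:R)) + ln (1 / alpha)))) ->
        ((1 - eta k alpha N)%R%:E <=
          P [set w | forall A : {set 'Z_N}, A \subset W w ->
                       (alpha * #|W w|%:R <= #|A|%:R)%R ->
                       has_kAP k (sumset A)])%E].
Proof.
pose N1 := (Num.truncn (expR 1 : R)).+1.
exists 1, 1; split=> // theta C th0 th1 C0.
pose bound (ka : nat * R) (D : R) (n0 : nat) :=
  forall (N : nat) (p : R), (2 < N)%N -> (n0 <= N)%N ->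
    C * N%:R `^ (- theta) < p -> p <= 1 ->
  forall (d : measure_display) (T : measurableType d)
    (P : probability T R) (W : T -> {set 'Z_N}), random_subset P p W ->
  1 < ln (N%:R : R) -> 1 * ln (ln N%:R) / Num.sqrt (ln N%:R) <= ka.2 ->
  ((1 - D / Num.sqrt N%:R)%R%:E <=
    P [set w | forall A : {set 'Z_N}, A \subset W w ->
       (ka.2 * #|W w|%:R <= #|A|%:R)%R -> has_kAP ka.1 (sumset A)])%E.
(* Each pair [(k, alpha)] gets its own constant and threshold, since [eta] may depend on both. *)
have /choice[Dn DnP] : forall ka, exists Dn : R * nat, bound ka Dn.1 Dn.2.
  move=> [k alpha]; have [alpha0|alpha_le0] := ltP 0 alpha.
    have [D [n0 H]] := progression_probability k th0 th1 C0 alpha0.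
    by exists (D, n0) => N p N2 n0N Cp p1 d T P W rW _ _; exact: H rW.
  (* For [alpha <= 0] the lower bound on [alpha] contradicts the positivity of [ln (ln N%:R)], so
     any values will do. *)
  exists (0, 0%N) => N p _ _ _ _ d T P W _ lnN le.
  have : 0 < ln (ln N%:R) / Num.sqrt (ln N%:R) :> R.
    by rewrite divr_gt0 ?ln_gt0// sqrtr_gt0 (lt_trans ltr01).
  by rewrite ltNge -[ln _]mul1r (le_trans le).
(* Below the threshold the value 1 makes the claimed lower bound 0. *)
exists (fun k alpha N => if (N < maxn N1 (Dn (k, alpha)).2)%N then 1
  else (Dn (k, alpha)).1 / Num.sqrt N%:R); split.
  by move=> k alpha; exact: cvg_div_sqrt.
move=> N p N2 Cp p1 d T P W rW alpha k alpha_ge _.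
case: ltnP => [_|]; first by rewrite subrr measure_ge0.
rewrite geq_max => /andP[N1N n0N].
by apply: (DnP (k, alpha) N p) => //; exact: one_lt_ln.
Qed.
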